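(* Let $n\ge 2$, let $\check{\mathcal Q}_{C_n}=\sqrt2\,\mathbb Z^n$ be the type $C_n$ coroot lattice, and let $\iota:\check{\mathcal Q}_{C_n}\to\check{\mathcal Q}_{2n}$, $\iota(x_1,\dots,x_n)=\frac1{\sqrt2}(x_1,\dots,x_n,-x_n,\dots,-x_1)$. The map $\mathbf x\mapsto\lambda_{\iota(\mathbf x)}$ is a $\widetilde W(C_n)$-equivariant bijection between $\check{\mathcal Q}_{C_n}$ and the set of self-conjugate $2n$-cores. Moreover, for every $\mathbf x\in\check{\mathcal Q}_{C_n}$, $$\check{\mathrm{size}}_i(\mathbf x)=\begin{cases}\mathrm{size}_i(\lambda_{\iota(\mathbf x)})+\mathrm{size}_{2n-i}(\lambda_{\iota(\mathbf x)})&\text{if }1\le i<n,\\ \mathrm{size}_i(\lambda_{\iota(\mathbf x)})&\text{if }i=0,n,\end{cases}$$ and hence $\check{\mathrm{size}}(\mathbf x)=\mathrm{size}(\lambda_{\iota(\mathbf x)})$.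
   Context: Partitions and cores. For $m\ge2$ an $m$-core is an integer partition with no hook of length $m$. Let $\check{\mathcal Q}_m=\{q\in\mathbb Z^m:\sum q_j=0\}$. For $q\in\check{\mathcal Q}_m$, define a bi-infinite word with positions $p\in\mathbb Z$: write $p=m(\ell-1)+j$ with $\ell\in\mathbb Z$, $1\le j\le m$, and put $\bullet$ at position $p$ if $\ell\le q_j$, and $\circ$ otherwise. Reading the word in increasing $p$ with $\bullet$ an up-step and $\circ$ a right-step traces, from bottom left to top right, the boundary of a unique partition (English notation); this is $\lambda_q$. (Its parts are the nonzero numbers $\#\{p'<p:\ p'\text{ is }\circ\}$ over positions $p$ carrying $\bullet$.) The map $q\mapsto\lambda_q$ is a bijection from $\check{\mathcal Q}_m$ to $m$-cores. The content of the box in row $u$, column $v$ is $v-u$; $\mathrm{size}_i(\lambda)$ is the number of boxes of $\lambda$ with content $\equiv i$ mod $m$ (here $m=2n$), and $\mathrm{size}(\lambda)$ is the total number of boxes. The affine symmetric group $\widetilde{\mathfrak S}_m$ acts on $\check{\mathcal Q}_m$: $s_i^A$ ($1\le i<m$) swaps coordinates $i,i+1$, and $s_0^A(q_1,\dots,q_m)=(q_m+1,q_2,\dots,q_{m-1},q_1-1)$. It acts on $m$-cores by letting $s_i^A$ add all addable boxes of content $i$ mod $m$, or remove all removable boxes of content $i$ mod $m$. Type $C_n$. Simple roots $\alpha_i=\frac1{\sqrt2}(e_i-e_{i+1})$ for $1\le i<n$, $\alpha_n=\sqrt2e_n$ in $\mathbb R^n$ with the standard inner product. The affine Weyl group $\widetilde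 W(C_n)$ acts on $\check{\mathcal Q}_{C_n}$ by: $s_i$ swaps $x_i,x_{i+1}$ for $1\le i<n$; $s_n$ negates $x_n$; $s_0$ replaces $x_1$ by $\sqrt2-x_1$. On self-conjugate $2n$-cores it acts by $s_i\mapsto s_i^As_{2n-i}^A$ for $1\le i<n$, $s_n\mapsto s_n^A$, $s_0\mapsto s_0^A$. Define $\check{\mathrm{size}}_i(\mathbf x)=\langle\frac{c_i}2\mathbf x-\check\omega_i,\mathbf x\rangle$ for $0\le i\le n$ and $\check{\mathrm{size}}=\sum_{i=0}^n\check{\mathrm{size}}_i$, where $\check\omega_0=0$, $\check\omega_i$ ($1\le i\le n$) is the basis dual to the simple roots (so $\check\omega_i=\sqrt2(e_1+\dots+e_i)$ for $i<n$, $\check\omega_n=\frac1{\sqrt2}(e_1+\dots+e_n)$), $c_0=1$, and $c_i$ are the coefficients of the highest root $\sqrt2e_1$ in simple roots ($c_i=2$ for $1\le i<n$, $c_n=1$). *)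

(* Defs.v *)
From mathcomp Require Import all_boot all_order all_algebra.
From mathcomp Require Import boolp classical_sets functions reals.
From mathcomp Require Import zify.

Set Implicit Arguments.
Unset Strict Implicit.
Unset Printing Implicit Defensive.

Import Order.TTheory GRing.Theory Num.Theory.

(* Diagrams are in English notation, with rows and columns numbered from 0. *)

Definition is_partition (la : seq nat) : bool := sorted geq la && (0 \notin la).

Definition row_len (la : seq nat) (u : nat) : nat := nth 0 la u.
Definition col_len (la : seq nat) (v : nat) : nat := count (fun a => v < a) la.

Definition conjugate (la : seq nat) : seq nat :=
  [seq col_len la v | v <- iota 0 (row_len la 0)].

Definition boxes (la : seq nat) : seq (nat * nat) :=
  [seq (u, v) | u <- iota 0 (size la), v <- iota 0 (row_len la u)].

(* arm + leg + 1, for a box of [la] *)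
Definition hook_length (la : seq nat) (b : nat * nat) : nat :=
  (row_len la b.1 - b.2.+1) + (col_len la b.2 - b.1.+1) + 1.

Definition is_core (m : nat) (la : seq nat) : Prop :=
  is_partition la /\ forall b, b \in boxes la -> hook_length la b <> m.

Definition self_conjugate_core (m : nat) (la : seq nat) : Prop :=
  is_core m la /\ conjugate la = la.

(* [b] has content congruent to [i] modulo [m]; the numbering from 0 does not
   affect the content *)
Definition has_residue (m i : nat) (b : nat * nat) : bool :=
  (b.2%:Z - b.1%:Z == i%:Z %[mod m%:Z])%Z.

Definition part_size (la : seq nat) : nat := size (boxes la).
Definition part_size_res (m i : nat) (la : seq nat) : nat :=
  count (has_residue m i) (boxes la).

(* The only box of row [u] that may be addable is [(u, row_len la u)], and the
   only one that may be removable is [(u, (row_len la u).-1)]. *)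
Definition addable_res (m i : nat) (la : seq nat) (u : nat) : bool :=
  ((u == 0) || (row_len la u < row_len la u.-1))
  && has_residue m i (u, row_len la u).
Definition removable_res (m i : nat) (la : seq nat) (u : nat) : bool :=
  (row_len la u.+1 < row_len la u) && has_residue m i (u, (row_len la u).-1).

(* An m-core never has both addable and removable boxes of the same residue, so
   on cores the test below only selects which of the two moves applies. Row
   [size la] is the empty row below the diagram. *)
Definition sA (m i : nat) (la : seq nat) : seq nat :=
  let rows := iota 0 (size la).+1 in
  let new_row u :=
    if has (addable_res m i la) rows then row_len la u + addable_res m i la u
    else row_len la u - removable_res m i la u in
  [seq a <- [seq new_row u | u <- rows] | 0 < a].

(* Coordinates are numbered from 1: [coord x k] is only meaningful for [1 <= k <= n]. *)
Definition coord {T : zmodType} {n : nat} (x : 'rV[T]_n) (k : nat) : T :=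
  if insub k.-1 is Some j then x ord0 j else 0%R.

Local Open Scope ring_scope.

Lemma coordE (T : zmodType) (n : nat) (x : 'rV[T]_n) (j : 'I_n) :
  coord x j.+1 = x ord0 j.
Proof. by rewrite /coord /= valK. Qed.

Definition coroot_A (m : nat) (q : 'rV[int]_m) : Prop := \sum_(j < m) q ord0 j = 0.

(* [bullet q p]: the letter at position p = m(l - 1) + j, with 1 <= j <= m, is an
   up-step; see [bulletE]. *)
Definition bullet (m : nat) (q : 'rV[int]_m) (p : int) : bool :=
  ((p - 1) %/ m)%Z + 1 <= coord q `|((p - 1) %% m)%Z|.+1.

(* All the positions p with -mN < p <= mN, where N is the sum of the |q_j|: the
   letters before are all bullets and those after all circles, see
   [bullet_before] and [circle_after]. *)
Definition window (m : nat) (q : 'rV[int]_m) : seq int :=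
  let B := (m * \sum_(j < m) `|q ord0 j|)%N in
  [seq k.+1%:Z - B%:Z | k <- iota 0 (2 * B)].

(* The parts are read off in increasing order along the word. *)
Definition lambda (m : nat) (q : 'rV[int]_m) : seq nat :=
  let part p := count (fun p' => (p' < p) && ~~ bullet q p') (window q) in
  rev [seq a <- [seq part p | p <- window q & bullet q p] | (0 < a)%N].

Lemma bulletE (m : nat) (q : 'rV[int]_m) (l : int) (j : 'I_m) :
  bullet q (m%:Z * (l - 1) + j.+1%:Z) = (l <= q ord0 j).
Proof.
have m0 : m%:Z != 0 by case: m q j => [q []|].
rewrite /bullet; have -> : m%:Z * (l - 1) + j.+1%:Z - 1 = (l - 1) * m%:Z + j%:Z.
  by rewrite -addn1 PoszD addrA addrK mulrC.
rewrite divzMDl // modzMDl divz_small ?modz_small //= ?ltz_nat ?ltn_ord //.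
by rewrite addr0 subrK coordE.
Qed.

Lemma posE (m : nat) (p : int) : (0 < m)%N ->
  exists l (j : 'I_m), p = m%:Z * (l - 1) + j.+1%:Z.
Proof.
move=> m0.
have mz : m%:Z != 0 by rewrite eqz_nat -lt0n.
have h0 := modz_ge0 (p - 1) mz.
have hlt : (`|((p - 1) %% m)%Z| < m)%N.
  by rewrite -ltz_nat gez0_abs // ltz_pmod // ltz_nat.
exists (((p - 1) %/ m)%Z + 1), (Ordinal hlt) => /=.
by rewrite addrK -addn1 PoszD gez0_abs // addrA (mulrC m%:Z) -divz_eq subrK.
Qed.

Lemma bullet_before (m : nat) (q : 'rV[int]_m) (p : int) : (0 < m)%N ->
  p <= - (m * \sum_(j < m) `|q ord0 j|)%N%:Z -> bullet q p.
Proof.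
move=> m0; case: (posE p m0) => l [j ->]; rewrite bulletE PoszM -mulrN => h.
have {h} : m%:Z * (l - 1) < m%:Z * - (\sum_(j < m) `|q ord0 j|)%N%:Z.
  by apply: lt_le_trans h; rewrite ltrDl.
rewrite ltr_pM2l ?ltz_nat // ltrBlDr ltzD1 => h; apply: (le_trans h).
rewrite lerNl; apply: (@le_trans _ _ `|q ord0 j|); first by rewrite -normrN ler_norm.
by rewrite -abszE lez_nat (bigD1 j) //= leq_addr.
Qed.

Lemma circle_after (m : nat) (q : 'rV[int]_m) (p : int) : (0 < m)%N ->
  (m * \sum_(j < m) `|q ord0 j|)%N%:Z < p -> ~~ bullet q p.
Proof.
move=> m0; case: (posE p m0) => l [j ->]; rewrite bulletE PoszM -ltNge => h.
have {h} : m%:Z * (\sum_(j < m) `|q ord0 j|)%N%:Z < m%:Z * l.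
  apply: (lt_le_trans h); rewrite mulrBr mulr1 -addrA gerDl addrC subr_le0.
  by rewrite lez_nat ltn_ord.
rewrite ltr_pM2l ?ltz_nat // => h; apply: le_lt_trans h.
apply: (le_trans (ler_norm _)).
by rewrite -abszE lez_nat (bigD1 j) //= leq_addr.
Qed.

Section TypeC.
Context {R : realType}.
Implicit Types n i : nat.

Definition dot n (x y : 'rV[R]_n) : R := \sum_(j < n) x ord0 j * y ord0 j.

(* The standard basis vector e_k, for 1 <= k <= n. *)
Definition e_ n (k : nat) : 'rV[R]_n := \row_(j < n) (j.+1 == k)%:R.

Definition simple_root n i : 'rV[R]_n :=
  if i == n then Num.sqrt 2 *: e_ n n else (Num.sqrt 2)^-1 *: (e_ n i - e_ n i.+1).

Definition highest_root n : 'rV[R]_n := Num.sqrt 2 *: e_ n 1.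

Definition highest_coef n i : R := if (i == 0%N) || (i == n) then 1 else 2.

(* For i = 0 the sum is empty, hence the coweight is 0. *)
Definition coweight n i : 'rV[R]_n :=
  if i == n then (Num.sqrt 2)^-1 *: \sum_(1 <= k < n.+1) e_ n k
  else Num.sqrt 2 *: \sum_(1 <= k < i.+1) e_ n k.

Definition coroot_C n (x : 'rV[R]_n) : Prop :=
  forall j : 'I_n, exists k : int, x ord0 j = Num.sqrt 2 * k%:~R.

Definition csize_res n i (x : 'rV[R]_n) : R :=
  dot ((highest_coef n i / 2) *: x - coweight n i) x.

Definition csize n (x : 'rV[R]_n) : R := \sum_(0 <= i < n.+1) csize_res i x.

Definition sC n i (x : 'rV[R]_n) : 'rV[R]_n :=
  \row_(j < n) let k := j.+1 in
    if i == 0%N then (if k == 1%N then Num.sqrt 2 - coord x k else coord x k)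
    else if i == n then (if k == n then - coord x k else coord x k)
    else if k == i then coord x i.+1
    else if k == i.+1 then coord x i
    else coord x k.

Definition sC_core n i (la : seq nat) : seq nat :=
  if (i == 0%N) || (i == n) then sA (2 * n) i la
  else sA (2 * n) i (sA (2 * n) (2 * n - i) la).

(* An element of the affine Weyl group is given by a word in the simple
   reflections; [:: i1; ...; ik] stands for s_i1 ... s_ik. Two words give the
   same element when they act in the same way on R^n. *)
Definition weyl_word n : Type := seq 'I_n.+1.

Definition weyl_act n (w : weyl_word n) (x : 'rV[R]_n) : 'rV[R]_n :=
  foldr (fun i : 'I_n.+1 => sC i) x w.

Definition weyl_eq n (w w' : weyl_word n) : Prop :=
  forall x : 'rV[R]_n, weyl_act w x = weyl_act w' x.

Definition weyl_act_core n (w : weyl_word n) (la : seq nat) : seq nat :=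
  foldr (fun i : 'I_n.+1 => sC_core n i) la w.

(* The vector (x_1, ..., x_n, - x_n, ..., - x_1) / sqrt 2. *)
Definition iota_vec n (x : 'rV[R]_n) : 'rV[R]_(2 * n) :=
  (Num.sqrt 2)^-1 *:
  \row_(j < (2 * n)%N) let k := j.+1 in
    if (k <= n)%N then coord x k else - coord x (2 * n + 1 - k)%N.

(* The same vector with coordinates in [int]; the floor does not change the
   image of the lattice, see [iota_CE]. *)
Definition iota_C n (x : 'rV[R]_n) : 'rV[int]_(2 * n) := map_mx Num.floor (iota_vec x).

Let sqrt2_neq0 : Num.sqrt 2 != 0 :> R.
Proof. by rewrite gt_eqF // sqrtr_gt0. Qed.

Lemma iota_CE n (x : 'rV[R]_n) : coroot_C x -> map_mx intr (iota_C x) = iota_vec x.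
Proof.
move=> hx; apply/rowP => j; rewrite !mxE /=.
have hc k : exists z : int, coord x k = Num.sqrt 2 * z%:~R.
  by rewrite /coord; case: insubP => [u _ _|_]; [exact: hx|exists 0; rewrite mulr0].
set t := (if _ then _ else _).
have [z ->] : exists z : int, t = Num.sqrt 2 * z%:~R.
  rewrite /t; case: ifP => _; first exact: hc.
  by have [z ->] := hc (2 * n + 1 - j.+1)%N; exists (- z); rewrite rmorphN mulrN.
by rewrite mulKf // intrKfloor.
Qed.

Lemma iota_C_coroot n (x : 'rV[R]_n) : coroot_C x -> coroot_A (iota_C x).
Proof.
move=> /iota_CE h; apply/eqP; rewrite -(intr_eq0 R) rmorph_sum /=; apply/eqP.
rewrite (eq_bigr (fun j => iota_vec x ord0 j)); last by move=> j _; rewrite -h [RHS]mxE.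
suff s0 : \sum_j iota_vec x ord0 j = - \sum_j iota_vec x ord0 j.
  by move/eqP: s0; rewrite -addr_eq0 -mulr2n mulrn_eq0 => /eqP.
rewrite -sumrN (reindex_inj rev_ord_inj) /=; apply: eq_bigr => j _.
rewrite !mxE /= -mulrN; congr (_ * _).
have jn := ltn_ord j.
have -> : ((2 * n - j.+1).+1 <= n)%N = ~~ (j.+1 <= n)%N.
  by apply/idP/idP; lia.
have -> : (2 * n + 1 - (2 * n - j.+1).+1 = j.+1)%N by lia.
by case: ltnP => //= _; rewrite opprK; congr (coord x _); lia.
Qed.

Lemma weyl_act_coroot n (w : weyl_word n) (x : 'rV[R]_n) :
  coroot_C x -> coroot_C (weyl_act w x).
Proof.
move=> hx; elim: w => [//|i w IH] j.
rewrite -[weyl_act _ x]/(sC i (weyl_act w x)) mxE /=.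
set y := weyl_act w x.
have hc k : exists z : int, coord y k = Num.sqrt 2 * z%:~R.
  by rewrite /coord; case: insubP => [u _ _|_]; [exact: IH|exists 0; rewrite mulr0].
have [z hz] := hc j.+1.
do ![case: ifP => _] => //.
- by exists (1 - z); rewrite hz rmorphB mulrBr mulr1.
- by exists (- z); rewrite hz rmorphN mulrN.
Qed.

Lemma dot_e n (x : 'rV[R]_n) k : (1 <= k <= n)%N -> dot x (e_ n k) = coord x k.
Proof.
case: k => [//|k] /= hk; rewrite /dot (bigD1 (Ordinal hk)) //= mxE eqxx mulr1.
rewrite -[k.+1]/((Ordinal hk).+1) coordE big1 ?addr0 // => j jk; rewrite mxE /=.
by rewrite eqSS -[k]/(nat_of_ord (Ordinal hk)) (inj_eq val_inj) (negPf jk) mulr0.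
Qed.

Lemma coord_coweight n i k : (1 <= k <= n)%N ->
  coord (coweight n i) k =
  (if i == n then (Num.sqrt 2)^-1 else Num.sqrt 2) * (k <= i)%N%:R.
Proof.
case: k => [//|k] /= hk; rewrite -[k.+1]/((Ordinal hk).+1) coordE.
have E l : (\sum_(1 <= k < l.+1) e_ n k) ord0 (Ordinal hk) = (k < l)%N%:R.
  rewrite summxE; elim: l => [|l IH]; first by rewrite big_nil.
  rewrite big_nat_recr //= IH mxE /= eqSS ltnS.
  by case: ltngtP; rewrite ?addr0 ?add0r.
by rewrite /coweight; case: eqP => [->|_]; rewrite mxE E.
Qed.

Lemma coweight_dual n i k : (1 <= i <= n)%N -> (1 <= k <= n)%N ->
  dot (coweight n i) (simple_root n k) = (i == k)%:R.
Proof.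
move=> hi hk.
have dotZ a (u v : 'rV[R]_n) : dot u (a *: v) = a * dot u v.
  by rewrite /dot mulr_sumr; apply: eq_bigr => j _; rewrite mxE mulrCA.
have dotB (u v w : 'rV[R]_n) : dot u (v - w) = dot u v - dot u w.
  by rewrite /dot -sumrB; apply: eq_bigr => j _; rewrite !mxE mulrBr.
rewrite /simple_root; case: (eqVneq k n) => [kn|kn].
  rewrite dotZ dot_e ?coord_coweight; try lia.
  rewrite kn; case: (eqVneq i n) => [->|ni]; first by rewrite leqnn mulr1 divff.
  have -> : (n <= i)%N = false by lia.
  by rewrite !mulr0.
rewrite dotZ dotB !dot_e; try lia.
rewrite !coord_coweight; try lia.
case: (eqVneq i n) => [->|ni].
  have -> : (k <= n)%N by lia.
  have -> : (k < n)%N by lia.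
  by rewrite subrr mulr0 eq_sym (negPf kn).
rewrite -mulrBr mulKf //.
by case: ltngtP; rewrite ?subrr ?subr0.
Qed.

Lemma highest_rootE n : (2 <= n)%N ->
  highest_root n = \sum_(1 <= i < n.+1) highest_coef n i *: simple_root n i.
Proof.
move=> hn; case: n hn => [//|n] hn.
have s2 : 2 * (Num.sqrt 2)^-1 = Num.sqrt 2 :> R.
  by rewrite -{1}[2]sqr_sqrtr // expr2 mulfK.
rewrite big_nat_recr //=.
have -> : \sum_(1 <= i < n.+1) highest_coef n.+1 i *: simple_root n.+1 i
        = Num.sqrt 2 *: (\sum_(1 <= i < n.+1) (e_ n.+1 i - e_ n.+1 i.+1)).
  rewrite scaler_sumr; apply: eq_big_nat => i hi.
  rewrite /highest_coef /simple_root.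
  have -> : (i == n.+1) = false by lia.
  have -> : (i == 0%N) = false by lia.
  by rewrite /= scalerA s2.
have -> : \sum_(1 <= i < n.+1) (e_ n.+1 i - e_ n.+1 i.+1) = e_ n.+1 1 - e_ n.+1 n.+1.
  rewrite -[RHS]opprB -telescope_sumr // -sumrN.
  by apply: eq_bigr => i _; rewrite opprB.
by rewrite /highest_coef /simple_root eqxx orbT scale1r -scalerDr subrK.
Qed.

End TypeC.

(* Main.v *)
Require Import Defs.
From mathcomp Require Import all_boot all_order all_algebra.
From mathcomp Require Import boolp classical_sets functions reals.
From mathcomp Require Import zify ring.
Require Import Defs.

Import Order.TTheory GRing.Theory Num.Theory.
Local Open Scope classical_set_scope.
Local Open Scope ring_scope.

Set Implicit Arguments.
Unset Strict Implicit.
Unset Printing Implicit Defensive.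

(** The boundary word of a partition [la] is recorded by its beads: row [u] puts a
    bead at [row_len la u - u], and [la] is determined by the set of its beads.
    Everything in the theorem becomes transparent on this set.

    - Columns record the complement: column [v] sits at [v + 1 - col_len la v]
      ([beadNP]). Hence conjugation reflects the word by [p -> 1 - p] and exchanges
      the two letters ([bead_conjugate]), and a hook of length [m] is a bead [p]
      such that [p - m] carries none ([core_bead]).
    - So an m-core is a word in which, on each residue class mod m, the beads are
      the positions up to some threshold: it is the word [bullet q] of the vector
      [q] of the thresholds ([core_encoded]). Conversely, when the entries of [q]
      sum to 0, the list [lambda q] has this word ([encodes_lambda]). Conjugation
      acts on [q] by reversal and negation ([encodes_conjugate]); its fixed points
      are the vectors [mirror y], which are the images of the type C coroots
      ([self_conjugate_coreP]). This gives the bijection.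
    - Adding or removing the boxes of residue [i] swaps the letters at [p] and
      [p + 1] for all [p] congruent to [i] ([bead_sA]); on [q] this is the
      reflection [s_i] of the affine symmetric group ([encodes_sA]). The type C
      reflections fold pairs of these ([mirror_sC_end], [mirror_sC_mid]), whence
      equivariance. The action of the Weyl group on self-conjugate cores is then
      transported from the lattice, so it depends only on the group element.
    - Row [u] consists of boxes of contents [- u, ..., beta la u - 1], and the number
      of those congruent to [i] is [F (beta la u) - F (- u)] with
      [F p] the floor of [(p - 1 - i) / m]. The number of boxes of residue [i] is
      thus the sum of [F] over the beads of [la] minus the sum over the beads of the
      empty partition. Summed along the residue classes these are sums of
      arithmetic progressions, and the total is the quadratic form of [size_resE].
      Restricted to [mirror y] it is the formula of the theorem. *)

(** * Partitions and their beads *)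

Local Arguments row_len : simpl never.
Local Arguments col_len : simpl never.

Section Beads.
Implicit Types (la : seq nat) (u v : nat) (p : int).

(** A diagram read by rows and by columns: both sides say that the box
    [(u, v)] belongs to it. *)
Lemma row_col la u v :
  sorted geq la -> (v < row_len la u)%N = (u < col_len la v)%N.
Proof.
rewrite /row_len /col_len; elim: la u => [|a la IH] u /= sla.
  by rewrite nth_nil !ltn0.
have {}IH := IH _ (path_sorted sla).
have [va|av] /= := ltnP v a; first by case: u => [|u] //=; rewrite IH.
have c0 : count (fun b => (v < b)%N) la = 0%N.
  apply/eqP; rewrite -leqn0 leqNgt -has_count; apply/hasP => -[b bla].
  have /allP/(_ b bla) := order_path_min (rev_trans leq_trans) sla.
  by rewrite /geq /=; lia.
by case: u => [|u] /=; rewrite ?IH c0; lia.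
Qed.

Lemma row_len_anti la u w :
  is_partition la -> (u <= w)%N -> (row_len la w <= row_len la u)%N.
Proof.
case/andP=> sla _ uw; case E : (row_len la w) => [//|r].
by rewrite row_col // (leq_ltn_trans uw) // -row_col // E.
Qed.

Lemma row_len_default la u : (size la <= u)%N -> row_len la u = 0%N.
Proof. exact: nth_default. Qed.

(** The end of row [u] on the boundary, one more than the content of its last box;
    the rows below the diagram are counted, so the empty partition has its beads
    at 0, -1, -2, and so on. *)
Definition beta la u : int := (row_len la u)%:Z - u%:Z.

(** A bead at [p] comes from a row of the diagram or from the empty row [- p], which
    bounds the search and makes the predicate boolean. *)
Definition bead la p : bool :=
  p \in [seq beta la u | u <- iota 0 (size la + `|p|).+1].

Lemma beadP la p : reflect (exists u, p = beta la u) (bead la p).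
Proof.
apply: (iffP mapP) => [[u _ ->]|[u pE]]; first by exists u.
exists u => //; rewrite mem_iota /= add0n.
rewrite pE /beta; case: (leqP (size la) u) => [hu|]; last by lia.
by rewrite row_len_default //; lia.
Qed.

Lemma bead_beta la u : bead la (beta la u).
Proof. by apply/beadP; exists u. Qed.

Lemma beta_anti la u w :
  is_partition la -> (u < w)%N -> beta la w < beta la u.
Proof.
move=> pla uw; have := row_len_anti pla (ltnW uw); rewrite /beta; lia.
Qed.

Lemma beta_inj la : is_partition la -> injective (beta la).
Proof.
move=> pla u w E.
by case: (ltngtP u w) => // /(beta_anti pla); rewrite E ltxx.
Qed.

(** The boundary path crosses each diagonal exactly once, either along a row end or
    along a column end. When [p] is not a bead, the column is found just above the
    first row that ends before [p]. *)
Lemma beadNP la p :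
  is_partition la ->
  reflect (exists v, p = v%:Z + 1 - (col_len la v)%:Z) (~~ bead la p).
Proof.
move=> pla; have sla : sorted geq la by case/andP: pla.
apply: (iffP idP) => [Np|[v pE]]; last first.
  apply/negP => /beadP[u]; rewrite pE /beta => E.
  by have := row_col u v sla; case: ltnP; case: ltnP; lia.
have ex : exists u, beta la u <= p.
  exists (size la + `|p|)%N.
  by rewrite /beta row_len_default ?leq_addr //; lia.
have lt_min : beta la (ex_minn ex) < p.
  case: ex_minnP => u up _; rewrite lt_neqAle up andbT.
  by apply: contraNneq Np => <-; exact: bead_beta.
move: lt_min; case: ex_minnP => u _ umin; rewrite {1}/beta => up.
exists (absz (p + u%:Z - 1)%R).
suff -> : col_len la (absz (p + u%:Z - 1)%R) = u by lia.
have Hv := row_col u (absz (p + u%:Z - 1)%R) sla.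
case: u => [|u] in up umin Hv *; first by lia.
have Hv' := row_col u (absz (p + u.+1%:Z - 1)%R) sla.
have pu : p < beta la u by rewrite ltNge; apply/negP => /umin; rewrite ltnn.
by move: pu; rewrite /beta; lia.
Qed.

(** The row ends are strictly decreasing, so the largest bead is the end of row 0,
    the next one that of row 1, and so on. *)
Lemma bead_inj la la' :
  is_partition la -> is_partition la' -> bead la =1 bead la' -> la = la'.
Proof.
move=> pla pla' E.
have half l1 l2 u : is_partition l1 -> is_partition l2 -> bead l1 =1 bead l2 ->
    (forall w, (w < u)%N -> row_len l1 w = row_len l2 w) ->
    (row_len l1 u <= row_len l2 u)%N.
  move=> p1 p2 E12 IH; have := bead_beta l1 u; rewrite E12 => /beadP[w uw].
  have [wu|] := ltnP w u.
    have /(beta_inj p1) uwE : beta l1 u = beta l1 w by rewrite uw /beta IH.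
    by rewrite uwE ltnn in wu.
  by move=> uw'; have := row_len_anti p2 uw'; move: uw; rewrite /beta; lia.
have rowE u : row_len la u = row_len la' u.
  elim/ltn_ind: u => u IH; apply/eqP; rewrite eqn_leq; apply/andP; split.
    exact: half.
  by apply: half => // w /IH.
have pos l u : is_partition l -> (u < size l)%N = (0 < row_len l u)%N.
  case/andP=> _ l0; rewrite /row_len; case: ltnP => hu; last by rewrite nth_default.
  by rewrite lt0n; apply/esym; apply: contraNneq l0 => <-; exact: mem_nth.
apply: (@eq_from_nth _ 0%N) => [|u _]; last exact: rowE.
have := pos la (size la') pla; have := pos la' (size la') pla'.
have := pos la (size la) pla; have := pos la' (size la) pla'.
rewrite !rowE !ltnn; lia.
Qed.

Lemma filter_pos_partition (s : seq nat) :
  sorted geq s -> is_partition [seq a <- s | (0 < a)%N].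
Proof.
move=> ss; rewrite /is_partition mem_filter ltnn andbT.
exact: sorted_filter (rev_trans leq_trans) _ _ ss.
Qed.

Lemma row_len_filter_pos (s : seq nat) u :
  sorted geq s -> row_len [seq a <- s | (0 < a)%N] u = nth 0%N s u.
Proof.
rewrite /row_len; elim: s u => [|a s IH] u //= ss.
have {}IH := IH _ (path_sorted ss); case: (posnP a) => [a0|_] /=; last by case: u.
have s0 b : b \in s -> b = 0%N.
  move=> bs; have /allP/(_ b bs) := order_path_min (rev_trans leq_trans) ss.
  by rewrite a0 /geq /=; lia.
rewrite IH a0; have nths k : nth 0%N s k = 0%N.
  by case: (ltnP k (size s)) => [/(mem_nth 0%N)/s0|/(nth_default 0%N)].
by case: u => [|u] /=; rewrite nths.
Qed.

(** Every partition built below is a list of row lengths from which the zeros are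
    filtered out; since zeros come last, the filter does not shift any row. *)
Lemma partition_of_fun (f : nat -> nat) k :
    (forall u, (f u.+1 <= f u)%N) -> (forall u, (k <= u)%N -> f u = 0%N) ->
    let la := [seq a <- [seq f u | u <- iota 0 k] | (0 < a)%N] in
  is_partition la /\ forall u, row_len la u = f u.
Proof.
move=> fS f0 la; have ss : sorted geq [seq f u | u <- iota 0 k].
  apply: (homo_sorted (e := leq)) (iota_sorted 0 k) => u w uw.
  by rewrite /geq /= -(subnK uw); elim: (_ - _)%N => // d; apply: leq_trans (fS _).
split=> [|u]; first exact: filter_pos_partition.
rewrite row_len_filter_pos //; case: (ltnP u k) => uk.
  by rewrite (nth_map 0%N) ?size_iota // nth_iota.
by rewrite nth_default ?f0 // size_map size_iota.
Qed.

Lemma conjugate_partition la : is_partition la ->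
  is_partition (conjugate la) /\ forall v, row_len (conjugate la) v = col_len la v.
Proof.
move=> pla; have sla : sorted geq la by case/andP: pla.
have colS v : (col_len la v.+1 <= col_len la v)%N.
  by apply: sub_count => a /=; lia.
have col0 v : (row_len la 0 <= v)%N -> col_len la v = 0%N.
  by move=> hv; have := row_col 0 v sla; lia.
have [] := partition_of_fun colS col0.
suff -> : [seq a <- [seq col_len la v | v <- iota 0 (row_len la 0)] | (0 < a)%N]
        = conjugate la by [].
apply/all_filterP/allP => _ /mapP[v hv ->].
by move: hv; rewrite mem_iota add0n -row_col.
Qed.

(** The row ends of the conjugate are the column ends of [la] up to [p -> 1 - p]. *)
Lemma bead_conjugate la p :
  is_partition la -> bead (conjugate la) p = ~~ bead la (1 - p).
Proof.
move=> pla; have [_ rowE] := conjugate_partition pla.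
apply/beadP/(beadNP _ pla) => -[v] E; exists v; move: E; rewrite /beta rowE; lia.
Qed.

Lemma box_in la u v : ((u, v) \in boxes la) = (v < row_len la u)%N.
Proof.
apply/allpairsPdep/idP => [[x [y [_ hy [-> ->]]]]|hv].
  by move: hy; rewrite mem_iota.
exists u, v; split=> //; rewrite mem_iota //=.
by rewrite ltnNge; apply/negP => /row_len_default E; rewrite E in hv.
Qed.

(** If row [u] ends at [p] and column [v] is at [p'], then the hook of the box
    [(u, v)] has length [p - p'], and the box lies in the diagram when [p' < p]. *)
Lemma core_bead m la : (0 < m)%N -> is_partition la ->
  is_core m la <-> forall p, bead la p -> bead la (p - m%:Z).
Proof.
move=> m0 pla; have sla : sorted geq la by case/andP: pla.
split=> [[_ hk] p /beadP[u ->]|hb].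
  apply/negPn/negP => /(beadNP _ pla)[v E].
  apply: (hk (u, v)); have := row_col u v sla;
    rewrite ?box_in /hook_length /=; move: E; rewrite /beta; lia.
split=> // -[u v]; rewrite box_in => uv hm.
have := hb _ (bead_beta la u); apply/negP/(beadNP _ pla); exists v.
move: hm; have := row_col u v sla; rewrite /hook_length /beta /=; lia.
Qed.
End Beads.

(** * Adding and removing boxes of one residue *)

Section SymmetricAction.
Implicit Types (la : seq nat) (u v : nat) (p l : int).

(** The involution of the positions exchanging [p] and [p + 1] for every [p]
    congruent to [i] mod [m]; it needs [1 < m] for these pairs to be disjoint. *)
Definition swap_pos (m i : nat) p : int :=
  if (p == i%:Z %[mod m%:Z])%Z then p + 1
  else if (p == i%:Z + 1 %[mod m%:Z])%Z then p - 1 else p.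

Lemma addable_resE m i la u : is_partition la ->
  addable_res m i la u
  = (beta la u == i%:Z %[mod m%:Z])%Z && ~~ bead la (beta la u + 1).
Proof.
move=> pla; rewrite /addable_res andbC; congr (_ && _).
case: u => [|u] /=.
  apply/esym/negP => /beadP[w E].
  by have := row_len_anti pla (leq0n w); move: E; rewrite /beta; lia.
have := row_len_anti pla (leqnSn u); rewrite leq_eqVlt => /orP[/eqP E|lt].
  rewrite E ltnn; apply/esym/negbF/beadP; exists u; rewrite /beta; lia.
rewrite lt; apply/esym/negP => /beadP[w E].
have wu : (w < u.+1)%N.
  rewrite ltnNge; apply/negP => uw; have := row_len_anti pla uw.
  by move: E; rewrite /beta; lia.
have := row_len_anti pla (wu : w <= u)%N; move: E; rewrite /beta; lia.
Qed.

Lemma removable_resE m i la u : is_partition la ->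
  removable_res m i la u
  = (beta la u - 1 == i%:Z %[mod m%:Z])%Z && ~~ bead la (beta la u - 1).
Proof.
move=> pla; rewrite /removable_res.
have := row_len_anti pla (leqnSn u); rewrite leq_eqVlt => /orP[/eqP E|lt].
  rewrite E ltnn; apply/esym/andP => -[_ /negP]; apply.
  by apply/beadP; exists u.+1; rewrite /beta; lia.
rewrite lt andTb andbC.
have -> : ~~ bead la (beta la u - 1).
  apply/negP => /beadP[w E]; have uw : (u < w)%N.
    rewrite ltnNge; apply/negP => wu; have := row_len_anti pla wu.
    by move: E; rewrite /beta; lia.
  by have := row_len_anti pla uw; move: E; rewrite /beta; lia.
rewrite /has_residue /= /beta; congr ((_ %% _)%Z == _); lia.
Qed.

(** On a residue class mod [m], the beads of an m-core form an initial segment. *)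
Lemma core_down m la p p' : (0 < m)%N -> is_core m la ->
  (p == p' %[mod m%:Z])%Z -> p' <= p -> bead la p -> bead la p'.
Proof.
move=> m0 cla; have [pla _] := cla; have [/(_ cla) down _] := core_bead m0 pla.
rewrite eqz_mod_dvd => /dvdzP[k kE] pp' hp.
have {kE} [d ->] : exists d : nat, p' = p - d%:Z * m%:Z.
  by exists (absz k); rewrite gez0_abs; nia.
elim: d => [|d IH]; first by rewrite mul0r subr0.
by have := down _ IH; congr (bead _ _); lia.
Qed.

(** A box of content [p] is addable when [p] is a bead and [p + 1] is not: adding it
    moves the bead from [p] to [p + 1]. Swapping the two letters would also remove
    the removable boxes of the same residue, but a core cannot have both kinds,
    because the beads on the class of [i] and on that of [i + 1] are initial
    segments. So the move performed is the full swap. *)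
Lemma bead_sA m i la : (1 < m)%N -> is_core m la ->
  is_partition (sA m i la) /\ bead (sA m i la) =1 bead la \o swap_pos m i.
Proof.
move=> m1 cla; have m0 := ltnW m1; have [pla _] := cla.
pose rows := iota 0 (size la).+1.
pose new_row u :=
  (if has (addable_res m i la) rows then row_len la u + addable_res m i la u
   else row_len la u - removable_res m i la u)%N.
have add_row u : addable_res m i la u -> (u < (size la).+1)%N.
  case: u => [|u] //; rewrite /addable_res /= => /andP[h _].
  by rewrite ltnS ltnNge; apply/negP => /(@row_len_default la) E; rewrite E in h.
have newS u : (new_row u.+1 <= new_row u)%N.
  have := row_len_anti pla (leqnSn u); rewrite /new_row /addable_res /removable_res.
  by case: ifP => _ /=; do 2 case: has_residue; rewrite ?andbF ?andbT; lia.
have new0 u : ((size la).+1 <= u)%N -> new_row u = 0%N.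
  move=> hu; rewrite /new_row (@row_len_default _ u (ltnW hu)) sub0n.
  by case: ifP => // _; case: (boolP (addable_res _ _ _ _)) => // /add_row; lia.
have [psA rowE] := partition_of_fun newS new0; split=> // p /=.
have mS x : (x == x + 1 %[mod m%:Z])%Z = false.
  rewrite eqz_mod_dvd opprD addNKr dvdzE /= dvdn1; lia.
have shift x y : (x == y %[mod m%:Z])%Z -> (x + 1 == y + 1 %[mod m%:Z])%Z.
  by rewrite !eqz_mod_dvd (_ : x + 1 - (y + 1) = x - y) //; lia.
have unshift x y : (x == y + 1 %[mod m%:Z])%Z -> (x - 1 == y %[mod m%:Z])%Z.
  by rewrite !eqz_mod_dvd (_ : x - 1 - y = x - (y + 1)) //; lia.
have notboth x : (x == i%:Z + 1 %[mod m%:Z])%Z -> (x == i%:Z %[mod m%:Z])%Z = false.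
  by move=> /eqP ->; rewrite eq_sym mS.
have betaE u : beta (sA m i la) u = (new_row u)%:Z - u%:Z.
  by rewrite /beta; congr (Posz _ - _); exact: rowE.
have [Hadd|Hno] := boolP (has (addable_res m i la) rows).
  have newE u : beta (sA m i la) u = beta la u + (addable_res m i la u)%:Z.
    by rewrite betaE /new_row Hadd /beta; lia.
  move/hasP: Hadd => [u0 _]; rewrite addable_resE // => /andP[u0i /negP Nu0].
  (* An addable box excludes removable ones: the position [beta la u0] is a bead
     and its successor is not, and both classes are initial segments. *)
  have norem x : (x == i%:Z %[mod m%:Z])%Z -> bead la (x + 1) -> bead la x.
    move=> xi; have xu0 : (x == beta la u0 %[mod m%:Z])%Z.
      by rewrite (eqP xi) eq_sym.
    have [u0x|xu0'] := leP (beta la u0) x => hx.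
      by case: Nu0; apply: (core_down m0 cla _ _ hx); rewrite ?shift //; lia.
    by apply: (core_down m0 cla _ (ltW xu0') (bead_beta la u0)); rewrite eq_sym.
  rewrite /swap_pos; apply/beadP/idP => [[u ->]|].
    rewrite newE addable_resE //.
    case: (boolP (beta la u == i%:Z %[mod m%:Z])%Z) => [bi|bi] /=.
      case: (boolP (bead la (beta la u + 1))) => /= hb; first by rewrite addr0 bi.
      by rewrite (notboth _ (shift _ _ bi)) shift // addrK bead_beta.
    rewrite addr0 (negbTE bi); case: ifP => [bi1|_]; last exact: bead_beta.
    by apply: norem; rewrite ?unshift // subrK bead_beta.
  case: ifP => [pi hb|pi].
    have /beadP[u uE] := norem _ pi hb.
    by exists u; rewrite newE addable_resE // -uE pi hb /=; lia.
  case: ifP => [pi1 /beadP[u uE]|pi1 /beadP[u uE]].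
    have [/beadP[w wE]|hp] := boolP (bead la p).
      by exists w; rewrite newE addable_resE // -wE pi /=; lia.
    by exists u; rewrite newE addable_resE // -uE unshift // subrK hp; lia.
  by exists u; rewrite newE addable_resE // -uE pi /=; lia.
have newE u : beta (sA m i la) u = beta la u - (removable_res m i la u)%:Z.
  rewrite betaE /new_row (negbTE Hno) /beta; rewrite /removable_res.
  by case: (ltnP (row_len la u.+1)) => /=; lia.
have addN x : (x == i%:Z %[mod m%:Z])%Z -> bead la x -> bead la (x + 1).
  move=> xi /beadP[u uE]; apply: contraNT Hno => hx; apply/hasP; exists u.
    by rewrite mem_iota /=; apply: add_row; rewrite addable_resE // -uE xi hx.
  by rewrite addable_resE // -uE xi hx.
rewrite /swap_pos; apply/beadP/idP => [[u ->]|].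
  rewrite newE removable_resE //.
  case: (boolP (beta la u - 1 == i%:Z %[mod m%:Z])%Z) => [bi|bi] /=.
    have bi1 := shift _ _ bi; rewrite subrK in bi1.
    case: (boolP (bead la (beta la u - 1))) => /= hb; last by rewrite bi subrK bead_beta.
    by rewrite subr0 (notboth _ bi1) bi1.
  rewrite subr0; case: ifP => [bi1|_]; first exact: addN bi1 (bead_beta _ _).
  case: ifP => [/unshift bi1|_]; last exact: bead_beta.
  by rewrite bi1 in bi.
case: ifP => [pi /beadP[u uE]|pi].
  have [/beadP[w wE]|hp] := boolP (bead la p).
    exists w; rewrite newE removable_resE // -wE [X in X && _]negbTE ?subr0 //.
    by apply/negP => /shift; rewrite subrK => /notboth; rewrite pi.
  by exists u; rewrite newE removable_resE // -uE addrK pi hp; lia.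
case: ifP => [pi1 hb|pi1 /beadP[u uE]].
  have := addN _ (unshift _ _ pi1) hb; rewrite subrK => /beadP[u uE].
  by exists u; rewrite newE removable_resE // -uE hb andbF /=; lia.
exists u; rewrite newE removable_resE // -uE [X in X && _]negbTE ?subr0 //.
by apply/negP => /shift; rewrite subrK pi1.
Qed.
End SymmetricAction.

(** * Cores and integer vectors *)

Section Encoding.
Variable m : nat.
Implicit Types (q : 'rV[int]_m) (la : seq nat) (p l : int).

(** Such a partition exists precisely when the entries of [q] sum to 0; arguing on a
    given pair keeps this condition out of the lemmas on the action of reflections
    and on conjugation. *)
Definition encodes q la : Prop := is_partition la /\ bead la =1 bullet q.

Lemma encodes_uniq q la la' : encodes q la -> encodes q la' -> la = la'.
Proof.
by move=> [pla E] [pla' E']; apply: bead_inj => // p; rewrite E E'.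
Qed.

Lemma bullet_coord q l k : (1 <= k <= m)%N ->
  bullet q (m%:Z * (l - 1) + k%:Z) = (l <= coord q k).
Proof.
by case: k => // k hk; rewrite (bulletE q l (Ordinal hk)) -coordE.
Qed.

Lemma pos_coord p : (0 < m)%N ->
  exists l k, (1 <= k <= m)%N /\ p = m%:Z * (l - 1) + k%:Z.
Proof.
by move=> m0; have [l [j ->]] := posE p m0; exists l, j.+1; rewrite ltn_ord.
Qed.

Lemma bullet_inj q q' : bullet q =1 bullet q' -> q = q'.
Proof.
move=> E; apply/rowP => j; apply/eqP; rewrite eq_le.
by rewrite -!bulletE E -E !bulletE !lexx.
Qed.

Lemma encodes_core q la : (0 < m)%N -> encodes q la -> is_core m la.
Proof.
move=> m0 [pla E]; apply/core_bead => // p; rewrite !E.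
have [l [k [hk ->]]] := pos_coord p m0.
have -> : m%:Z * (l - 1) + k%:Z - m%:Z = m%:Z * (l - 1 - 1) + k%:Z by ring.
by rewrite !bullet_coord //; lia.
Qed.

Lemma threshold (f : int -> bool) a b :
    (forall l, f (l + 1) -> f l) -> f a -> ~~ f b ->
  exists c, forall l, f l = (l <= c).
Proof.
move=> fS fa fb.
have down l d : f (l + d%:Z) -> f l.
  by elim: d => [|d IH]; rewrite ?addr0 // -addn1 PoszD addrA => /fS.
have ex : exists d : nat, ~~ f (a + d%:Z).
  exists (absz (b - a)%R); have [ab|ba] := leP a b.
    by rewrite (_ : a + _ = b) //; lia.
  case/negP: fb; apply: (down b (absz (a - b)%R)).
  by rewrite (_ : b + _ = a) //; lia.
case: (ex_minnP ex) => -[|d] Nd dmin; first by rewrite addr0 fa in Nd.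
exists (a + d%:Z) => l; have [ld|dl] := leP l (a + d%:Z).
  apply/idP; apply: (down l (absz (a + d%:Z - l)%R)).
  rewrite (_ : l + _ = a + d%:Z); last by lia.
  by apply/negPn/negP => /dmin; rewrite ltnn.
apply/idP => fl; case/negP: Nd; apply: (down _ (absz (l - (a + d.+1%:Z))%R)).
by rewrite (_ : a + _ + _ = l) //; lia.
Qed.

Lemma bead_low la p : p <= - (size la)%:Z -> bead la p.
Proof.
move=> hp; apply/beadP; exists (absz p).
by rewrite /beta row_len_default; lia.
Qed.

Lemma bead_high la p : is_partition la -> (row_len la 0)%:Z < p -> ~~ bead la p.
Proof.
move=> pla hp; apply/negP => /beadP[u E].
by have := row_len_anti pla (leq0n u); move: E; rewrite /beta; lia.
Qed.

(** The entry [q_j] is the last index [l] at which the class of [j] carries a bead. *)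
Lemma core_encoded la : (0 < m)%N -> is_core m la -> exists q, encodes q la.
Proof.
move=> m0 cla; have [pla _] := cla; have [/(_ cla) down _] := core_bead m0 pla.
have /fin_all_exists[c cE] (j : 'I_m) :
    exists c, forall l, bead la (m%:Z * (l - 1) + j.+1%:Z) = (l <= c).
  apply: (@threshold _ (- (size la)%:Z) ((row_len la 0)%:Z + 1)) => [l /down||].
  - by congr bead; ring.
  - by apply: bead_low; have := ltn_ord j; nia.
  - by apply: bead_high => //; nia.
exists (\row_j c j); split=> // p; have [l [j ->]] := posE p m0.
by rewrite bulletE cE mxE.
Qed.

Definition conj_vec q : 'rV[int]_m := \row_j - q ord0 (rev_ord j).

(** The reflection [p -> 1 - p] maps the class of [j] to that of [m + 1 - j] and
    the index [l] to [1 - l]; exchanging the letters turns the bound [q_j] into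
    [- q_j]. *)
Lemma encodes_conjugate q la : (0 < m)%N ->
  encodes q la -> encodes (conj_vec q) (conjugate la).
Proof.
move=> m0 [pla E]; split=> [|p]; first by case: (conjugate_partition pla).
rewrite bead_conjugate // E; have [l [j ->]] := posE p m0; rewrite bulletE mxE.
have -> : 1 - (m%:Z * (l - 1) + j.+1%:Z) = m%:Z * (1 - l - 1) + (rev_ord j).+1%:Z.
  by have /= := ltn_ord j; lia.
by rewrite bulletE; lia.
Qed.

Lemma self_conjugateE q la : (0 < m)%N -> encodes q la ->
  conjugate la = la <-> conj_vec q = q.
Proof.
move=> m0 ela; have [_ Ec] := encodes_conjugate m0 ela; split=> [cl|cq].
  by apply: bullet_inj => p; rewrite -Ec cl; case: ela => _ ->.
by have := encodes_conjugate m0 ela; rewrite cq => /encodes_uniq; apply.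
Qed.

(** The type A reflections; for [i = 0] the neighbours are the last class and the
    first one, and going from one to the other changes the index by one. *)
Definition s_vec (i : nat) q : 'rV[int]_m :=
  \row_(j < m) let k := j.+1 in
    if i == 0%N then
      if k == 1%N then coord q m + 1 else if k == m then coord q 1 - 1 else coord q k
    else if k == i then coord q i.+1
    else if k == i.+1 then coord q i
    else coord q k.

Lemma coord_s_vec i q k : (1 <= k <= m)%N ->
  coord (s_vec i q) k =
    if i == 0%N then
      if k == 1%N then coord q m + 1 else if k == m then coord q 1 - 1 else coord q k
    else if k == i then coord q i.+1
    else if k == i.+1 then coord q i
    else coord q k.
Proof. by case: k => // k hk; rewrite (coordE _ (Ordinal hk)) mxE. Qed.

(** The swap sends the class of [i] to that of [i + 1] with the same index, except
    for [i = 0], where position [m l] is followed by the first position of index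
    [l + 1]. *)
Lemma bullet_s_vec i q : (1 < m)%N -> (i < m)%N ->
  bullet (s_vec i q) =1 bullet q \o swap_pos m i.
Proof.
move=> m1 im p /=; have [l [k [hk ->]]] := pos_coord p (ltnW m1).
(* Positions are numbered from 1 to [m] within a period, so residue 0 is the
   class [k = m]. *)
have modk (c : nat) : (c <= m)%N ->
    (m%:Z * (l - 1) + k%:Z == c%:Z %[mod m%:Z])%Z
    = [|| k == c, (c == 0%N) && (k == m) | (c == m) && (k == 0%N)].
  move=> cm; rewrite (mulrC m%:Z) modzMDl !modz_nat eqz_nat.
  have modm a : (a <= m)%N -> (a %% m = if a == m then 0 else a)%N.
    by rewrite leq_eqVlt => /orP[/eqP->|am]; rewrite ?modnn ?eqxx // modn_small // ltn_eqF.
  rewrite !modm //; last by case/andP: hk.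
  by case: (eqVneq k m); case: (eqVneq c m) => /=; lia.
rewrite /swap_pos (_ : i%:Z + 1 = i.+1%:Z); last by lia.
rewrite !modk //; last exact: ltnW.
rewrite bullet_coord // coord_s_vec // (_ : (k == 0%N) = false); last by lia.
rewrite !andbF !orbF.
have [->|i0] /= := eqVneq i 0%N.
  rewrite (_ : (k == 0%N) = false) /=; last by lia.
  have [->|km] := eqVneq k m.
    rewrite (_ : (m == 1%N) = false) /=; last by lia.
    rewrite (_ : _ + 1 = m%:Z * (l + 1 - 1) + 1%:Z); last by ring.
    by rewrite bullet_coord; lia.
  have [->|k1] /= := eqVneq k 1%N; last by rewrite bullet_coord.
  rewrite (_ : _ - 1 = m%:Z * (l - 1 - 1) + m%:Z); last by ring.
  by rewrite bullet_coord; lia.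
have [->|ki] := eqVneq k i.
  by rewrite -addrA -(PoszD i 1) addn1 bullet_coord; lia.
have [->|ki1] := eqVneq k i.+1; last by rewrite bullet_coord.
rewrite (_ : m%:Z * (l - 1) + i.+1%:Z - 1 = m%:Z * (l - 1) + i%:Z); last by lia.
by rewrite bullet_coord; lia.
Qed.

Lemma encodes_sA i q la : (1 < m)%N -> (i < m)%N ->
  encodes q la -> encodes (s_vec i q) (sA m i la).
Proof.
move=> m1 im ela; have [_ E] := ela.
have [psA beadE] := bead_sA i m1 (encodes_core (ltnW m1) ela).
by split=> // p; rewrite beadE bullet_s_vec //= E.
Qed.

End Encoding.

(** * The word of a vector of sum zero *)

Section Segments.
Implicit Types (la : seq nat) (p l : int) (G : int -> int).

Definition segment (B : nat) : seq int := [seq k.+1%:Z - B%:Z | k <- iota 0 (2 * B)].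

Lemma mem_segment B p : (p \in segment B) = (- B%:Z < p <= B%:Z).
Proof.
apply/mapP/idP => [[k]|hp]; first by rewrite mem_iota => hk ->; lia.
by exists (absz (p + B%:Z - 1)%R); rewrite ?mem_iota; lia.
Qed.

Lemma segment_sorted B : sorted <%R (segment B).
Proof.
apply: (homo_sorted (e := ltn)) (iota_ltn_sorted 0 _) => a b /=; lia.
Qed.

Lemma segment_uniq B : uniq (segment B).
Proof. exact: lt_sorted_uniq (segment_sorted B). Qed.

Lemma count_segment_lt B p : p \in segment B ->
  (count (fun p' => p' < p) (segment B))%:Z = p - 1 + B%:Z.
Proof.
rewrite mem_segment => hp; have hk : (absz (p - 1 + B%:Z)%R < 2 * B)%N by lia.
have {1}-> : p = nth 0 (segment B) (absz (p - 1 + B%:Z)%R).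
  by rewrite (nth_map 0%N) ?size_iota // nth_iota //; lia.
rewrite (count_lt_nth 0 (segment_sorted B)) ?size_map ?size_iota //; lia.
Qed.

(** Once [B] bounds the number of rows and of columns, exactly the first [B] rows end
    in the segment. *)
Lemma sum_beads la B G :
    is_partition la -> (size la <= B)%N -> (row_len la 0 <= B)%N ->
  \sum_(p <- segment B | bead la p) G p = \sum_(0 <= u < B) G (beta la u).
Proof.
move=> pla sB rB; rewrite -big_filter -(big_map (beta la) xpredT G).
apply/perm_big/uniq_perm => [||p].
- exact: filter_uniq (segment_uniq B).
- by rewrite map_inj_uniq ?iota_uniq //; exact: beta_inj.
rewrite mem_filter mem_segment; apply/andP/mapP => [[/beadP[u ->] hu]|[u]].
  exists u => //; rewrite mem_index_iota /= ltnNge; apply/negP => Bu.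
  by move: hu; rewrite /beta row_len_default ?(leq_trans sB) //; lia.
rewrite mem_index_iota => hu ->; split; first exact: bead_beta.
have := row_len_anti pla (leq0n u); rewrite /beta; lia.
Qed.

Lemma sum_runners m n (H : nat -> int) :
  \sum_(0 <= k < n * m) H k = \sum_(j < m) \sum_(0 <= t < n) H (t * m + j)%N.
Proof.
rewrite big_nat_mul exchange_big /=; apply: eq_big_nat => t _.
rewrite -[X in \sum_(X <= _ < _) _]add0n big_addn mulSn addnK big_mkord.
by apply: eq_bigr => j _; rewrite addnC.
Qed.

(** On the class of [j], the bullets of the segment have the indices [- N < l <= q_j];
    here [t = l - 1 + N]. *)
Lemma sum_bullets m (q : 'rV[int]_m) (N : nat) G :
    (forall j, `|q ord0 j| <= N%:Z) ->
  \sum_(p <- segment (m * N) | bullet q p) G p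
  = \sum_(j < m) \sum_(0 <= t < absz (q ord0 j + N%:Z)%R)
      G (m%:Z * (t%:Z - N%:Z) + j.+1%:Z).
Proof.
move=> qN; rewrite big_map (_ : iota _ _ = index_iota 0 (2 * N * m)); last first.
  by rewrite /index_iota subn0; congr iota; lia.
rewrite big_mkcond sum_runners; apply: eq_bigr => j _.
have posE t : (t * m + j).+1%:Z - (m * N)%N%:Z = m%:Z * (t%:Z - N%:Z) + j.+1%:Z by lia.
under eq_bigr => t _.
  rewrite posE -[t%:Z - N%:Z](addrK 1) bulletE; over.
rewrite -big_mkcond /=.
have hj := qN j; rewrite [RHS](big_nat_widen 0 _ (2 * N)); last by lia.
by apply: eq_big => t; [lia|rewrite addrK].
Qed.

(** Let [s] be the increasing list of the [B] bullets in the segment. There are [B]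
    of them because the entries of [q] sum to 0. The position [s_i] is preceded in
    the segment by [s_i - 1 + B] letters, of which [i] are bullets; so the part it
    carries has length [s_i + u] with [u = B - 1 - i]. As row [u], this part ends at
    [s_i]. *)
Lemma encodes_lambda m (q : 'rV[int]_m) : (0 < m)%N -> coroot_A q ->
  encodes q (lambda q).
Proof.
move=> m0 q0; pose N := (\sum_(j < m) `|q ord0 j|)%N; pose B := (m * N)%N.
pose s := [seq p <- segment B | bullet q p].
have qN j : `|q ord0 j| <= N%:Z by rewrite -abszE lez_nat /N (bigD1 j) //= leq_addr.
have size_s : size s = B.
  apply/eqP; rewrite -eqz_nat -[(size s)%:Z]natz -sum1_size natr_sum big_filter sum_bullets //.
  have E j : \sum_(0 <= t < absz (q ord0 j + N%:Z)%R) 1%:R = q ord0 j + N%:Z :> int.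
    by rewrite sumr_const_nat subn0 -[RHS]gez0_abs; [lia|have := qN j; lia].
  rewrite (eq_bigr _ (fun j _ => E j)) big_split /= q0 add0r sumr_const card_ord.
  by apply/eqP; rewrite /B; lia.
pose part p := count (fun p' => (p' < p) && ~~ bullet q p') (segment B).
have lamE : lambda q = [seq a <- rev [seq part p | p <- s] | (0 < a)%N].
  by rewrite filter_rev.
have sorted_s : sorted <%R s by apply: lt_sorted_filter; exact: segment_sorted.
have part_nth i : (i < B)%N -> (part (nth 0 s i))%:Z = nth 0 s i - 1 + B%:Z - i%:Z.
  move=> iB; have : nth 0 s i \in s by rewrite mem_nth // size_s.
  rewrite mem_filter => /andP[_ /count_segment_lt <-].
  rewrite -{3}(count_lt_nth 0 sorted_s (i := i)) ?size_s // count_filter.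
  have count_split (a b : pred int) r :
      (count a r = count (predI a b) r + count (fun x => a x && ~~ b x) r)%N.
    by elim: r => //= x r ->; case: (a x); case: (b x); lia.
  by rewrite (count_split _ (bullet q)) PoszD addrAC subrr add0r.
have srt : sorted geq (rev [seq part p | p <- s]).
  rewrite rev_sorted; apply: (homo_sorted (e := <%R)) sorted_s => p p' pp'.
  by apply: sub_count => x /= /andP[xp ->]; rewrite (lt_trans xp pp').
rewrite lamE; split; first exact: filter_pos_partition.
have betaE u : beta [seq a <- rev [seq part p | p <- s] | (0 < a)%N] u
    = if (u < B)%N then nth 0 s (B - u.+1) else - u%:Z.
  rewrite /beta row_len_filter_pos //; case: ltnP => uB; last first.
    by rewrite nth_default ?size_rev ?size_map ?size_s // add0r.
  rewrite nth_rev ?size_map ?size_s // (nth_map 0) ?size_s; last by lia.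
  by rewrite part_nth; lia.
move=> p; apply/beadP/idP => [[u ->]|hp].
  rewrite betaE; case: ltnP => uB; last by apply: bullet_before => //; rewrite -/N; lia.
  have : nth 0 s (B - u.+1) \in s by rewrite mem_nth ?size_s //; lia.
  by rewrite mem_filter => /andP[].
have [pB|Bp] := leP p (- B%:Z).
  by exists (absz p); rewrite betaE ltnNge (_ : (B <= absz p)%N) /=; lia.
have ps : p \in s.
  rewrite mem_filter hp mem_segment Bp /= leNgt; apply/negP => /(circle_after m0).
  by rewrite hp.
have := ps; rewrite -index_mem size_s => hi.
exists (B - (index p s).+1)%N; rewrite betaE.
rewrite (_ : (_ < B)%N); last by lia.
by rewrite (_ : (B - _)%N = index p s) ?nth_index //; lia.
Qed.

End Segments.

(** * Counting boxes by residue *)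

Section Sizes.
Implicit Types (la : seq nat) (p l : int).

Lemma divz_step (m : nat) (x : int) : (0 < m)%N ->
  (x %/ m%:Z)%Z - ((x - 1) %/ m%:Z)%Z = (m%:Z %| x)%Z%:Z.
Proof.
move=> m0; have mz : m%:Z != 0 by lia.
have := ltz_pmod (x - 1) (d := m%:Z); have := modz_ge0 (x - 1) mz.
have := divz_eq (x - 1) m%:Z.
set a := ((x - 1) %/ _)%Z; set r := (_ %% _)%Z => xE r0 rm.
have {xE} -> : x = a * m%:Z + (r + 1) by lia.
rewrite divzMDl //; have [rE|rE] := eqVneq (r + 1) m%:Z.
  have -> : (m%:Z %| a * m%:Z + (r + 1))%Z.
    by apply/dvdzP; exists (a + 1); rewrite rE; ring.
  by rewrite rE divzz mz; lia.
rewrite divz_small; last by lia.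
case: dvdzP => [[k kE]|_] /=; last by lia.
have [ka|ka] := leP k a; nia.
Qed.

(** The contents of row [u] run from [- u] to [beta la u - 1], and the function
    [(p - 1 - i) %/ m] of [p] increases by one exactly after the [p] congruent to [i]. *)
Lemma sum_box_residues m i la : (0 < m)%N ->
  (part_size_res m i la)%:Z
  = \sum_(0 <= u < size la)
      (((beta la u - 1 - i%:Z) %/ m%:Z)%Z - ((- u%:Z - 1 - i%:Z) %/ m%:Z)%Z).
Proof.
move=> m0; rewrite /part_size_res -[Posz _]natz -sum1_count natr_sum big_mkcond /=.
rewrite /boxes big_allpairs_dep /= /index_iota subn0; apply: eq_bigr => u _.
rewrite /beta; elim: (row_len la u) => [|r IH]; first by rewrite big_nil add0r subrr.
rewrite -addn1 iotaD big_cat big_seq1 /= IH /has_residue /= add0n.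
rewrite eqz_mod_dvd.
have := divz_step (r%:Z - u%:Z - i%:Z) m0.
rewrite (_ : r%:Z - u%:Z - i%:Z - 1 = r%:Z - u%:Z - 1 - i%:Z); last by ring.
rewrite (_ : (r + 1)%N%:Z - u%:Z - 1 - i%:Z = r%:Z - u%:Z - i%:Z); last by lia.
case: (_ %| _)%Z => /=; lia.
Qed.

Lemma beta_nil u : beta [::] u = - u%:Z.
Proof. by rewrite /beta row_len_default // add0r. Qed.

Lemma encodes_nil m : (0 < m)%N -> encodes (0 : 'rV[int]_m) [::].
Proof.
move=> m0; split=> // p; apply/beadP/idP => [[u ->]|].
  have [l [k [hk E]]] := pos_coord (- u%:Z) m0.
  rewrite /beta row_len_default // add0r E bullet_coord // /coord.
  by case: insub => [j|]; rewrite ?mxE; nia.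
have [l [k [hk ->]]] := pos_coord p m0; rewrite bullet_coord //.
rewrite (_ : coord _ k = 0); last by rewrite /coord; case: insub => // j; rewrite mxE.
by exists (absz (m%:Z * (l - 1) + k%:Z)%R); rewrite /beta row_len_default //; nia.
Qed.

(** Both sums over row ends, for [la] and for the empty partition, are moved to a
    common segment of length [2 m N] and split along the residue classes. On each
    class the summand is affine in the index, and the terms that depend on [N]
    cancel in the difference. *)
Lemma size_resE m i (q : 'rV[int]_m) la : (i < m)%N -> encodes q la ->
  2 * (part_size_res m i la)%:Z
  = \sum_(j < m) q ord0 j ^+ 2 - 2 * \sum_(j < m | (j < i)%N) q ord0 j
    - \sum_(j < m) q ord0 j.
Proof.
move=> im [pla Ela]; have m0 : (0 < m)%N by case: m im {q Ela}.
have [pnil Enil] := encodes_nil m0.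
pose N := (size la + row_len la 0 + \sum_(j < m) `|q ord0 j|)%N; pose B := (m * N)%N.
have NB : (N <= B)%N by rewrite leq_pmull.
have sB : (size la <= B)%N by rewrite (leq_trans _ NB) // /N; lia.
have rB : (row_len la 0 <= B)%N by rewrite (leq_trans _ NB) // /N; lia.
have qN j : `|q ord0 j| <= N%:Z.
  by rewrite -abszE lez_nat /N (bigD1 j) //=; lia.
pose F p := ((p - 1 - i%:Z) %/ m%:Z)%Z.
have sizeE : (part_size_res m i la)%:Z
    = \sum_(0 <= u < B) F (beta la u) - \sum_(0 <= u < B) F (beta [::] u).
  rewrite sum_box_residues // -sumrB (big_nat_widen 0 _ B) // big_mkcond /=.
  apply: eq_big_nat => u _; rewrite beta_nil.
  case: ltnP => // su; by rewrite /F /beta row_len_default // add0r subrr.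
have resum q' la' : is_partition la' -> bead la' =1 bullet q' ->
    (size la' <= B)%N -> (row_len la' 0 <= B)%N -> (forall j, `|q' ord0 j| <= N%:Z) ->
    2 * \sum_(0 <= u < B) F (beta la' u) = \sum_(j < m)
      (q' ord0 j ^+ 2 - q' ord0 j - (j < i)%N%:Z * 2 * q' ord0 j
       + N%:Z * (- 1 - N%:Z - (j < i)%N%:Z * 2)).
  move=> p' E' sB' rB' qN'; rewrite -sum_beads // (eq_bigl _ _ E') sum_bullets //.
  rewrite mulr_sumr; apply: eq_bigr => j _.
  have FE t : F (m%:Z * (t%:Z - N%:Z) + j.+1%:Z) = t%:Z - N%:Z - (j < i)%N%:Z.
    rewrite /F (_ : _ - 1 - i%:Z = (t%:Z - N%:Z) * m%:Z + (j%:Z - i%:Z)); last by lia.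
    have jm := ltn_ord j; rewrite divzMDl; last by lia.
    congr (_ + _); case: ltnP => ij; last by rewrite divz_small //; lia.
    rewrite (_ : j%:Z - i%:Z = (- 1) * m%:Z + (m%:Z + j%:Z - i%:Z)); last by lia.
    by rewrite divzMDl ?divz_small //; lia.
  rewrite (eq_bigr _ (fun t _ => FE t)).
  have tri a (c : int) : 2 * \sum_(0 <= t < a) (t%:Z - N%:Z - c)
      = a%:Z ^+ 2 - a%:Z - 2 * a%:Z * (N%:Z + c).
    elim: a => [|a IH]; first by rewrite big_nil; ring.
    by rewrite big_nat_recr //= mulrDr IH -addn1 PoszD; ring.
  by rewrite tri gez0_abs; [ring|have := qN' j; lia].
rewrite sizeE mulrBr (resum _ _ pla Ela) // (resum _ _ pnil Enil) //; last first.
  by move=> j; rewrite mxE normr0.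
rewrite -sumrB mulr_sumr (big_mkcond (fun j : 'I_m => (j < i)%N)) /= -!sumrB; apply: eq_bigr => j _.
by rewrite mxE; case: (j < i)%N => /=; ring.
Qed.

Lemma sum_size_res m la : (0 < m)%N ->
  (\sum_(0 <= i < m) part_size_res m i la = part_size la)%N.
Proof.
move=> m0; rewrite /part_size -sum1_size /part_size_res.
under eq_bigr do rewrite -sum1_count big_mkcond.
rewrite exchange_big /=; apply: eq_bigr => b _.
have mz : m%:Z != 0 by lia.
set x := b.2%:Z - b.1%:Z; have := modz_ge0 x mz; have := ltz_pmod x (d := m%:Z).
move=> xm x0; rewrite big_mkord.
have hx : (absz (x %% m%:Z)%Z < m)%N by lia.
rewrite (bigD1 (Ordinal hx)) //= /has_residue -/x.
rewrite modz_nat modn_small // gez0_abs // eqxx big1 ?addn0 // => j jx.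
rewrite modz_nat modn_small // ifF //; apply: contraNF jx => /eqP E.
by apply/eqP/val_inj; rewrite /= E.
Qed.

End Sizes.

(** * Type C *)

Section TypeC.
Context {R : realType} (n : nat).
Implicit Types (x : 'rV[R]_n) (y : 'rV[int]_n) (la : seq nat) (i k : nat).

Definition coroot_of y : 'rV[R]_n := Num.sqrt 2 *: map_mx intr y.

(** The vector of [iota_C], without the factor [Num.sqrt 2] and without floors. *)
Definition mirror y : 'rV[int]_(2 * n) :=
  \row_(j < (2 * n)%N) if (j < n)%N then coord y j.+1 else - coord y (2 * n - j)%N.

Lemma sqrt2_neq0 : Num.sqrt 2 != 0 :> R.
Proof. by rewrite gt_eqF // sqrtr_gt0. Qed.

Lemma coord_coroot_of y k : coord (coroot_of y) k = Num.sqrt 2 * (coord y k)%:~R.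
Proof. by rewrite /coord; case: insub => [j|]; rewrite ?mxE // mulr0. Qed.

Lemma coroot_of_coroot y : coroot_C (coroot_of y).
Proof. by move=> j; exists (y ord0 j); rewrite !mxE. Qed.

Lemma coroot_CP x : coroot_C x -> exists y, x = coroot_of y.
Proof.
move=> /fin_all_exists[c cE]; exists (\row_j c j).
by apply/rowP => j; rewrite cE !mxE.
Qed.

Lemma iota_C_coroot_of y : iota_C (coroot_of y) = mirror y.
Proof.
apply/rowP => j; rewrite !mxE /= !coord_coroot_of -mulrN -rmorphN.
rewrite (_ : (2 * n + 1 - j.+1 = 2 * n - j)%N); last by lia.
by case: ifP => _; rewrite mulKf ?sqrt2_neq0 // intrKfloor.
Qed.

Lemma coord_mirror y k : (1 <= k <= 2 * n)%N ->
  coord (mirror y) k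
  = if (k <= n)%N then coord y k else - coord y (2 * n + 1 - k).
Proof.
case: k => // k hk; rewrite (coordE _ (Ordinal hk)) mxE /=.
by rewrite (_ : (2 * n + 1 - k.+1 = 2 * n - k)%N) //; lia.
Qed.

Lemma mirror_inj : injective mirror.
Proof.
move=> y y' E; apply/rowP => j; have := ltn_ord j => jn.
have := coord_mirror y (k := j.+1); have := coord_mirror y' (k := j.+1).
rewrite E jn => -> //; last by lia.
by rewrite !coordE => -> //; lia.
Qed.

Lemma conj_vec_mirror y : conj_vec (mirror y) = mirror y.
Proof.
apply/rowP => j; rewrite !mxE /=; have jn := ltn_ord j.
rewrite (_ : (2 * n - j.+1 < n)%N = ~~ (j < n)%N); last by lia.
case: ltnP => _ /=; rewrite ?opprK.
  by congr (coord y _); lia.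
by congr (- coord y _); lia.
Qed.

Lemma conj_vec_fixed (q : 'rV[int]_(2 * n)) :
  conj_vec q = q -> exists y, q = mirror y.
Proof.
move=> cq; exists (\row_(j < n) coord q j.+1); apply/rowP => j; rewrite mxE.
have ck k : (1 <= k <= n)%N -> coord (\row_(j < n) coord q j.+1) k = coord q k.
  by case: k => // k hk; rewrite (coordE _ (Ordinal hk)) mxE.
have jn := ltn_ord j; case: ltnP => hj; rewrite ck; try lia.
  by rewrite coordE.
rewrite -[in LHS]cq mxE -coordE; congr (- coord q _); rewrite /=; lia.
Qed.

Lemma self_conjugate_coreP la : (0 < n)%N ->
  self_conjugate_core (2 * n) la <-> exists y, encodes (mirror y) la.
Proof.
move=> n0; have m0 : (0 < 2 * n)%N by lia.
split=> [[/(core_encoded m0)[q ela]]|[y ela]].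
  by move/(self_conjugateE m0 ela)/conj_vec_fixed => [y yE]; exists y; rewrite -yE.
split; first exact: encodes_core ela.
by apply/(self_conjugateE m0 ela)/conj_vec_mirror.
Qed.

(** The action of [sC] on the vectors divided by [Num.sqrt 2]. *)
Definition sC_int i y : 'rV[int]_n :=
  \row_(j < n) let k := j.+1 in
    if i == 0%N then (if k == 1%N then 1 - coord y k else coord y k)
    else if i == n then (if k == n then - coord y k else coord y k)
    else if k == i then coord y i.+1
    else if k == i.+1 then coord y i
    else coord y k.

Lemma coord_sC_int i y k : (1 <= k <= n)%N ->
  coord (sC_int i y) k =
    if i == 0%N then (if k == 1%N then 1 - coord y k else coord y k)
    else if i == n then (if k == n then - coord y k else coord y k)
    else if k == i then coord y i.+1
    else if k == i.+1 then coord y i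
    else coord y k.
Proof. by case: k => // k hk; rewrite (coordE _ (Ordinal hk)) mxE. Qed.

Lemma sC_coroot_of i y : sC i (coroot_of y) = coroot_of (sC_int i y).
Proof.
apply/rowP => j; rewrite !mxE /= !coord_coroot_of.
by do ![case: ifP => _] => //; rewrite ?rmorphB ?rmorphN ?mulrBr ?mulr1 ?mulrN.
Qed.

(** Negating [y_n] exchanges the two middle entries of [mirror y]; replacing [y_1] by
    [1 - y_1] is the affine exchange of its first and last entries. *)
Lemma mirror_sC_end i y : (2 <= n)%N -> i = 0%N \/ i = n ->
  mirror (sC_int i y) = s_vec i (mirror y).
Proof.
move=> n2 hi; apply/rowP => j; have jn := ltn_ord j; rewrite -!coordE.
rewrite coord_s_vec //; case: hi => -> /=.
  rewrite !coord_mirror; try lia.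
  case: ltnP => hj; rewrite coord_sC_int /=; try lia.
    case: eqP => [->|j0]; last by rewrite ifF //; lia.
    rewrite (_ : (2 * n <= n)%N = false); last by lia.
    by rewrite (_ : (2 * n + 1 - 2 * n)%N = 1%N); [rewrite addrC|lia].
  rewrite (_ : (j.+1 == 1%N) = false); last by lia.
  case: (eqVneq j.+1 (2 * n)%N) => [E|E].
    rewrite (_ : (2 * n + 1 - j.+1)%N = 1%N) /=; last by lia.
    by rewrite opprB ifT //; lia.
  by rewrite ifF //; lia.
rewrite (_ : (n == 0%N) = false); last by lia.
rewrite !coord_mirror; try lia.
rewrite leqnn ltnn; case: ltnP => hj; rewrite coord_sC_int /=; try lia.
  rewrite (_ : (n == 0%N) = false) ?eqxx; last by lia.
  case: (eqVneq j.+1 n) => [->|E]; last by rewrite ifF //; lia.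
  by congr (- coord y _); lia.
rewrite (_ : (n == 0%N) = false) ?eqxx; last by lia.
rewrite (_ : (j.+1 == n) = false); last by lia.
case: (eqVneq (j : nat) n) => [E|E].
  rewrite ifT; last by lia.
  by rewrite E eqxx opprK; congr (coord y _); lia.
rewrite ifF; last by lia.
by rewrite ifF //; lia.
Qed.

(** Exchanging [y_i] and [y_{i+1}] also exchanges the opposite entries, at the places
    [2n - i] and [2n - i + 1]. *)
Lemma mirror_sC_mid i y : (1 <= i < n)%N ->
  mirror (sC_int i y) = s_vec i (s_vec (2 * n - i) (mirror y)).
Proof.
move=> hi; apply/rowP => j; have jn := ltn_ord j; rewrite -!coordE.
rewrite coord_s_vec ?coord_mirror; try lia.
rewrite !coord_s_vec ?coord_mirror; try lia.
rewrite (_ : (i == 0%N) = false); last by lia.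
rewrite (_ : (2 * n - i == 0)%N = false); last by lia.
rewrite (_ : (i.+1 == 2 * n - i)%N = false); last by lia.
rewrite (_ : (i.+1 == (2 * n - i).+1)%N = false); last by lia.
rewrite (_ : (i == 2 * n - i)%N = false); last by lia.
rewrite (_ : (i == (2 * n - i).+1)%N = false); last by lia.
rewrite (_ : (i < n)%N); last by lia.
rewrite (_ : (i <= n)%N); last by lia.
rewrite (_ : (2 * n - i < n)%N = false); last by lia.
rewrite (_ : (2 * n - i <= n)%N = false); last by lia.
case: ltnP => hj; rewrite coord_sC_int; try lia.
  rewrite (_ : (i == 0%N) = false); last by lia.
  rewrite (_ : (i == n) = false); last by lia.
  rewrite (_ : (j.+1 == 2 * n - i)%N = false); last by lia.
  by rewrite (_ : (j.+1 == (2 * n - i).+1)%N = false) //; lia.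
rewrite (_ : (i == 0%N) = false); last by lia.
rewrite (_ : (i == n) = false); last by lia.
rewrite (_ : (j.+1 == i) = false); last by lia.
rewrite (_ : (j.+1 == i.+1) = false); last by lia.
rewrite (_ : (2 * n + 1 - j.+1 == i)%N = (j.+1 == (2 * n - i).+1)%N); last by lia.
rewrite (_ : (2 * n + 1 - j.+1 == i.+1)%N = (j.+1 == 2 * n - i)%N); last by lia.
case: (eqVneq j.+1 (2 * n - i).+1) => E1.
  by rewrite ifF; [congr (- coord y _)|]; lia.
by case: eqVneq => E2 //; congr (- coord y _); lia.
Qed.

Lemma encodes_sC i x la : (2 <= n)%N -> (i <= n)%N -> coroot_C x ->
  encodes (iota_C x) la -> encodes (iota_C (sC i x)) (sC_core n i la).
Proof.
move=> n2 iN /coroot_CP[y ->]; rewrite sC_coroot_of !iota_C_coroot_of /sC_core => ela.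
have m1 : (1 < 2 * n)%N by lia.
case: ifP => hi.
  rewrite mirror_sC_end //; last by case/orP: hi => /eqP; [left|right].
  by apply: encodes_sA ela; lia.
rewrite mirror_sC_mid; last by lia.
by apply: encodes_sA; rewrite ?[(i < _)%N]leq_trans //; [lia|apply: encodes_sA ela; lia].
Qed.

Lemma encodes_weyl (w : weyl_word n) x la : (2 <= n)%N -> coroot_C x ->
  encodes (iota_C x) la -> encodes (iota_C (weyl_act w x)) (weyl_act_core w la).
Proof.
move=> n2 hx ela; elim: w => //= i w IH.
apply: encodes_sC IH => //; first by rewrite -ltnS.
exact: weyl_act_coroot.
Qed.

Lemma sum_mirror (g : 'I_(2 * n) -> int) (le : (n <= 2 * n)%N) :
  \sum_j g j = \sum_(j < n) (g (widen_ord le j) + g (rev_ord (widen_ord le j))).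
Proof.
rewrite (bigID (fun j : 'I_(2 * n) => (j < n)%N)) /= big_split /=.
congr (_ + _); first by rewrite (big_ord_narrow le).
rewrite (reindex_inj rev_ord_inj) /= -(big_ord_narrow le (F := g \o @rev_ord _)).
by apply: eq_bigl => j /=; have := ltn_ord j; lia.
Qed.

(** Half of the value of [size_resE] at [mirror y]; up to the factor [c_i], it is
    also the type C size. *)
Definition size_form i y : int := \sum_(j < n) (y ord0 j ^+ 2 - (j < i)%N%:Z * y ord0 j).

(** The entries of [mirror y] sum to 0 and the last [i] of them are opposite to the
    first [i], so the first [2n - i] have the same sum as the first [i]. *)
Lemma size_res_mirror i i' y la : (0 < n)%N -> (i <= n)%N ->
    i' = i \/ i' = (2 * n - i)%N -> (i' < 2 * n)%N -> encodes (mirror y) la ->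
  (part_size_res (2 * n) i' la)%:Z = size_form i y.
Proof.
move=> n0 iN hi' im /(size_resE im); have le : (n <= 2 * n)%N by lia.
have lo j : mirror y ord0 (widen_ord le j) = y ord0 j.
  by rewrite mxE /= ltn_ord coordE.
have hi j : mirror y ord0 (rev_ord (widen_ord le j)) = - y ord0 j.
  by rewrite -[in LHS](conj_vec_mirror y) mxE rev_ordK lo.
rewrite (big_mkcond (fun j : 'I_(2 * n) => (j < i')%N)) /= !(sum_mirror _ le).
rewrite [X in _ - X]big1; last by move=> j _; rewrite lo hi subrr.
rewrite subr0 => E; apply: (@mulfI _ 2) => //; rewrite E /size_form !mulr_sumr -sumrB.
apply: eq_bigr => j _; rewrite lo hi /=; have jn := ltn_ord j.
case: hi' => ->.
  rewrite (_ : (2 * n - j.+1 < i)%N = false); last by lia.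
  by case: (j < i)%N => /=; ring.
rewrite (_ : (j < 2 * n - i)%N); last by lia.
rewrite (_ : (2 * n - j.+1 < 2 * n - i)%N = ~~ (j < i)%N); last by lia.
by case: (j < i)%N => /=; ring.
Qed.

(** For [0 < i < n] the coefficient is 2, which matches the two residues [i] and
    [2n - i]; for [i = n] the coefficient 1 is balanced by the coweight, whose entries
    are half as large. *)
Lemma csize_res_coroot_of i y : (2 <= n)%N -> (i <= n)%N ->
  csize_res i (coroot_of y) = highest_coef n i * (size_form i y)%:~R.
Proof.
move=> n2 iN; rewrite /csize_res /dot /size_form rmorph_sum mulr_sumr /=.
have s2 : Num.sqrt 2 ^+ 2 = 2 :> R by rewrite sqr_sqrtr.
have s0 := sqrt2_neq0.
apply: eq_bigr => j _; have jn := ltn_ord j.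
have entryE c (u v : 'rV[R]_n) : (c *: u - v) ord0 j = c * u ord0 j - v ord0 j.
  by rewrite !mxE.
rewrite entryE -(coordE (coweight n i)) coord_coweight; last by lia.
rewrite -(coordE (coroot_of y)) coord_coroot_of coordE.
rewrite rmorphB rmorphXn rmorphM /=; set a : R := (y ord0 j)%:~R.
rewrite /highest_coef; case: (eqVneq i n) => [iE|iE] /=.
  rewrite orbT iE jn /=.
  have -> : (1 / 2 * (Num.sqrt 2 * a) - (Num.sqrt 2)^-1 * 1) * (Num.sqrt 2 * a)
    = 1 / 2 * Num.sqrt 2 ^+ 2 * a ^+ 2 - a by field.
  by rewrite s2; field.
rewrite orbF; have [i0|i0] /= := eqVneq i 0%N.
  rewrite i0 ltn0 /=.
  have -> : (1 / 2 * (Num.sqrt 2 * a) - Num.sqrt 2 * 0) * (Num.sqrt 2 * a)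
    = 1 / 2 * Num.sqrt 2 ^+ 2 * a ^+ 2 by ring.
  by rewrite s2; field.
have -> (b : R) : (2 / 2 * (Num.sqrt 2 * a) - Num.sqrt 2 * b) * (Num.sqrt 2 * a)
    = Num.sqrt 2 ^+ 2 * (a ^+ 2 - b * a) by field.
by rewrite s2.
Qed.

Lemma sum_fold_residues (f : nat -> nat) : (0 < n)%N ->
  (\sum_(0 <= i < 2 * n) f i
   = f 0 + \sum_(1 <= i < n) (f i + f (2 * n - i)) + f n)%N.
Proof.
move=> n0; rewrite (@big_cat_nat _ _ _ n) /=; [|lia..].
rewrite big_ltn // (@big_ltn _ _ _ n); last by lia.
rewrite big_split /=.
have -> : (\sum_(n.+1 <= i < 2 * n) f i = \sum_(1 <= i < n) f (2 * n - i))%N.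
  rewrite -[n.+1]/(1 + n)%N big_addn (_ : (2 * n - n)%N = n); last by lia.
  rewrite big_nat_rev /=; apply: eq_big_nat => i hi; congr f; lia.
lia.
Qed.

End TypeC.

Unset Implicit Arguments.

(** * The bijection, its equivariance and the sizes *)

Theorem theorem5p2 (R : realType) (n : nat) (hn : (2 <= n)%N) :
  [/\ set_bij [set x : 'rV[R]_n | coroot_C x]
              [set la : seq nat | self_conjugate_core (2 * n) la]
              (fun x : 'rV[R]_n => lambda (iota_C x)),
      (forall (w : weyl_word n) (la : seq nat), self_conjugate_core (2 * n) la ->
         self_conjugate_core (2 * n) (weyl_act_core w la)
         /\ forall w' : weyl_word n, weyl_eq (R := R) w w' ->
              weyl_act_core w la = weyl_act_core w' la),
      (forall (w : weyl_word n) (x : 'rV[R]_n), coroot_C x ->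
         lambda (iota_C (weyl_act w x)) = weyl_act_core w (lambda (iota_C x))),
      (forall x : 'rV[R]_n, coroot_C x ->
         (forall i : nat, (1 <= i < n)%N ->
            csize_res i x
            = (part_size_res (2 * n) i (lambda (iota_C x))
               + part_size_res (2 * n) (2 * n - i) (lambda (iota_C x)))%:R)
         /\
         (forall i : nat, i = 0%N \/ i = n ->
            csize_res i x = (part_size_res (2 * n) i (lambda (iota_C x)))%:R)) &
      (forall x : 'rV[R]_n, coroot_C x ->
         csize x = (part_size (lambda (iota_C x)))%:R)].
Proof.
have n0 : (0 < n)%N by lia.
have m0 : (0 < 2 * n)%N by lia.
have lamP (x : 'rV[R]_n) : coroot_C x -> encodes (iota_C x) (lambda (iota_C x)).
  by move=> hx; apply: encodes_lambda => //; exact: iota_C_coroot.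
(* Through this equivalence, two self-conjugate cores are compared by exhibiting a
   coroot that encodes both. *)
have coreP la : self_conjugate_core (2 * n) la <->
    exists2 x : 'rV[R]_n, coroot_C x & encodes (iota_C x) la.
  split=> [/(self_conjugate_coreP _ n0)[y ela]|[x /coroot_CP[y ->]]].
    exists (coroot_of y); first exact: coroot_of_coroot.
    by rewrite iota_C_coroot_of.
  by rewrite iota_C_coroot_of => ela; apply/self_conjugate_coreP => //; exists y.
have size_mid (x : 'rV[R]_n) i : coroot_C x -> (1 <= i < n)%N ->
    csize_res i x = (part_size_res (2 * n) i (lambda (iota_C x))
               + part_size_res (2 * n) (2 * n - i) (lambda (iota_C x)))%:R.
  move=> hx hi; have := lamP x hx; case/coroot_CP: hx => y ->.
  rewrite iota_C_coroot_of => ela; rewrite csize_res_coroot_of //; last by lia.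
  rewrite pmulrn PoszD !(size_res_mirror (i := i) _ _ _ _ ela); try lia.
  rewrite /highest_coef ifF; last by lia.
  by rewrite rmorphD /=; ring.
have size_end (x : 'rV[R]_n) i : coroot_C x -> i = 0%N \/ i = n ->
    csize_res i x = (part_size_res (2 * n) i (lambda (iota_C x)))%:R.
  move=> hx hi; have := lamP x hx; case/coroot_CP: hx => y ->.
  rewrite iota_C_coroot_of => ela; rewrite csize_res_coroot_of //; last by lia.
  rewrite pmulrn (size_res_mirror (i := i) _ _ _ _ ela); try lia.
  by rewrite /highest_coef ifT ?mul1r //; lia.
split=> //.
- split=> [x hx|x x' /set_mem hx /set_mem hx' E|la /coreP[x hx ela]].
  + by apply/coreP; exists x => //; exact: lamP.
  + have := lamP _ hx; have := lamP _ hx'; rewrite -E => -[_ E1] [_ E2].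
    have {E1 E2} : iota_C x = iota_C x' by apply: bullet_inj => p; rewrite -E1 -E2.
    case/coroot_CP: hx => y ->; case/coroot_CP: hx' => y' ->.
    by rewrite !iota_C_coroot_of => /mirror_inj ->.
  + by exists x => //; exact: encodes_uniq (lamP _ hx) ela.
(* With [la] encoded by [x], both words send [la] to the partition encoded by
   the common value of their actions on [x]. *)
- move=> w la /coreP[x hx ela]; split=> [|w' ww'].
    apply/coreP; exists (weyl_act w x); first exact: weyl_act_coroot.
    exact: encodes_weyl.
  apply: (encodes_uniq (encodes_weyl w hn hx ela)).
  by rewrite ww'; exact: encodes_weyl.
- move=> w x hx; apply: encodes_uniq (lamP _ (weyl_act_coroot w hx)) _.
  by apply: encodes_weyl => //; exact: lamP.
- by move=> x hx; split=> i hi; [exact: size_mid|exact: size_end].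
move=> x hx; rewrite /csize big_nat_recr //= big_ltn //.
rewrite -(sum_size_res _ m0) sum_fold_residues // !size_end //; try by [left|right].
rewrite !natrD natr_sum; congr (_ + _ + _).
by apply: eq_big_nat => i hi; exact: size_mid.
Qed.
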